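(* Let $\mathcal{V}_C(\rho,h)$ be a given velocity function. Consider, for a parameter $\varepsilon>0$, the relaxed model for the unknowns $(\rho,v,w)(t,x)$, $$ \text{(A)}\qquad \begin{cases} \partial_t \rho+\partial_x(\rho v)=0,\\[2pt] \partial_t v+\big(v-q'(h)\,\mathbf{h}'(\rho)\,\rho\big)\,\partial_x v=\dfrac{\mathcal{V}_C(\rho,h)-v}{\varepsilon},\\[2pt] \partial_t w+\partial_x(wv)=0, \end{cases} $$ where $w=\rho\big(h-\mathbf{h}(\rho)\big)$. Then the first-order correction to the local equilibrium approximation of (A) (the one obtained from the Chapman-Enskog expansion $v=\mathcal{V}_C(\rho,h)+\varepsilon v^{(1)}+\mathcal{O}(\varepsilon^2)$) reads $$ \text{(B)}\qquad \partial_t\begin{pmatrix}\rho\\ w\end{pmatrix} +\partial_x\begin{pmatrix}\mathcal{V}_C(\rho,h)\,\rho\\ \mathcal{V}_C(\rho,h)\,w\end{pmatrix} =-\varepsilon\,\partial_x\left(\mu_C(\rho,h)\,\partial_x\begin{pmatrix}\rho\\ h\end{pmatrix}\right)+\mathcal{O}(\varepsilon^2) $$ with diffusion matrix $$ \mu_C(\rho,h):=\Big(\lambda_1^C(\rho,h)-\big(\mathcal{V}_C(\rho,h)-q'(h)\mathbf{h}'(\rho)\rho\big)\Big) \begin{pmatrix} \rho\,\partial_\rho\mathcal{V}_C(\rho,h) & \rho\,\partial_h\mathcal{V}_C(\rho,h)\\ w\,\partial_\rho\mathcal{V}_C(\rho,h) & w\,\partial_h\mathcal{V}_C(\rho,h)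 \end{pmatrix}, $$ where $$ \lambda_1^C(\rho,h)=\mathcal{V}_C(\rho,h)+\rho\big[\partial_\rho\mathcal{V}_C(\rho,h)+\mathbf{h}'(\rho)\,\partial_h\mathcal{V}_C(\rho,h)\big]. $$ In particular, if the relation $$ q'(h)\,\mathbf{h}'(\rho)\,\rho=\mathcal{V}_C(\rho,h)-\lambda_1^C(\rho,h)=-\rho\big[\partial_\rho\mathcal{V}_C(\rho,h)+\mathbf{h}'(\rho)\,\partial_h\mathcal{V}_C(\rho,h)\big] $$ holds, then the relaxed model (A) and the local equilibrium approximation, i.e. (B) with the $\varepsilon$-term absent, coincide up to terms of order $\mathcal{O}(\varepsilon^2)$.
   Context: Here $\rho=\rho(t,x)>0$ is a traffic density, $v$ the mean velocity, $h$ a driver-dependent scalar quantity (hesitation/hysteresis). The functions $\mathbf{h}$ (of $\rho$), $q$ (of $h$) and $\mathcal{V}_C$ (of $(\rho,h)$) are given sufficiently smooth real functions. The bold symbol $\mathbf{h}(\cdot)$ denotes a given function, whereas $h$ is an unknown, related to $w$ by $h=\frac{w}{\rho}+\mathbf{h}(\rho)$. Chapman-Enskog expansion and first-order correction: one considers smooth solutions depending on $\varepsilon$ for which $v=\mathcal{V}_C(\rho,h)+\varepsilon v^{(1)}+\mathcal{O}(\varepsilon^2)$ as $\varepsilon\to0$, where $\rho$, $h$, $v^{(1)}$ and their derivatives are $\mathcal{O}(1)$. The coefficient $v^{(1)}$ is determined up to $\mathcal{O}(\varepsilon)$ by the second equation. As usual in such formal expansions, $\mathcal{O}(\varepsilon^k)$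 terms remain $\mathcal{O}(\varepsilon^k)$ after differentiation in $t$ and $x$. The first-order correction to the local equilibrium approximation is the system for $(\rho,w)$ obtained by inserting this expansion into the first and third equations and collecting terms up to $\mathcal{O}(\varepsilon^2)$. That the models ''coincide up to $\mathcal{O}(\varepsilon^2)$'' means that the equations for $(\rho,w)$ in (A), after inserting this expansion, agree with $\partial_t\rho+\partial_x(\mathcal{V}_C\rho)=0$, $\partial_t w+\partial_x(\mathcal{V}_C w)=0$ up to $\mathcal{O}(\varepsilon^2)$. *)

(* Defs.v *)
From Stdlib Require Import Reals.
From Coquelicot Require Import Coquelicot.
Open Scope R_scope.

(* Functions of (t, x), and families of such functions indexed by epsilon. *)
Definition field := R -> R -> R.
Definition family := R -> field.

Definition Dt (f : field) : field := fun t x => Derive (fun s => f s x) t.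
Definition Dx (f : field) : field := fun t x => Derive (fun y => f t y) x.

(* C^infinity on an open set. *)
Definition smooth1 (D : R -> Prop) (f : R -> R) : Prop :=
  forall (n : nat) (r : R), D r -> ex_derive_n f n r.

Definition smooth2 (D : R -> R -> Prop) (f : R -> R -> R) : Prop :=
  forall (n : nat) (a b : R), D a b -> ex_diff_n f n a b.

(* f = O(eps^k) as eps -> 0+, uniformly on K, for f and for all its derivatives
   in t and x (the constants may depend on the order (i, j)).  Taking for K all
   of Omega, a compact subset or a point gives the global, locally uniform or
   pointwise symbol.  Smoothness is required on the open set Omega, which
   contains K, so that the total operators Derive and partial_derive are the
   actual derivatives. *)
Definition bigO (Omega K : R -> R -> Prop) (eps0 : R) (k : nat) (f : family)
  : Prop :=
  (forall eps, 0 < eps < eps0 -> smooth2 Omega (f eps)) /\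
  forall i j : nat, exists C delta : R, 0 < delta /\
    forall eps, 0 < eps < delta -> eps < eps0 -> forall t x, K t x ->
      Rabs (partial_derive i j (f eps) t x) <= C * eps ^ k.

(* Vectors of R^2 and 2 x 2 matrices given by their two rows. *)
Definition vec2 : Type := R * R.
Definition mat2 : Type := vec2 * vec2.

Definition dot (u v : vec2) : R := fst u * fst v + snd u * snd v.

Definition matvec (M : mat2) (u : vec2) : vec2 := (dot (fst M) u, dot (snd M) u).

(* The given functions of the model: bh is the bold h (a function of rho), q a
   function of h, and V the velocity V_C (a function of (rho, h)). *)

Definition d_rho (V : R -> R -> R) (r h : R) : R := Derive (fun s => V s h) r.
Definition d_h (V : R -> R -> R) (r h : R) : R := Derive (fun s => V r s) h.

Definition lambda1 (bh : R -> R) (V : R -> R -> R) (r h : R) : R :=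
  V r h + r * (d_rho V r h + Derive bh r * d_h V r h).

(* The entry w of the diffusion matrix is the function r (h - bh r) of (r, h). *)
Definition mu_C (bh q : R -> R) (V : R -> R -> R) (r h : R) : mat2 :=
  let w := r * (h - bh r) in
  let c := lambda1 bh V r h - (V r h - Derive q h * Derive bh r * r) in
  ((c * (r * d_rho V r h), c * (r * d_h V r h)),
   (c * (w * d_rho V r h), c * (w * d_h V r h))).

Definition h_of (bh : R -> R) (rho w : field) : field :=
  fun t x => w t x / rho t x + bh (rho t x).

Definition V_of (bh : R -> R) (V : R -> R -> R) (rho w : field) : field :=
  fun t x => V (rho t x) (h_of bh rho w t x).

Definition solves_A (bh q : R -> R) (V : R -> R -> R) (eps : R)
    (Omega : R -> R -> Prop) (rho v w : field) : Prop :=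
  forall t x, Omega t x ->
    let r := rho t x in
    let h := h_of bh rho w t x in
    Dt rho t x + Dx (fun t x => rho t x * v t x) t x = 0 /\
    Dt v t x + (v t x - Derive q h * Derive bh r * r) * Dx v t x
      = (V r h - v t x) / eps /\
    Dt w t x + Dx (fun t x => w t x * v t x) t x = 0.

(* Smooth solutions of (A) on Omega, one for each 0 < eps < eps0, admitting the
   expansion v = V_C(rho, h) + eps v1 + O(eps^2).  The functions bh and V are
   smooth for densities in the open set dens.  The field ce_compact asks that
   rho stays, uniformly in eps, in a compact interval of dens: for dens = R this
   follows from rho = O(1), and for dens = (0, +oo), where bh and V may be
   singular at rho = 0, it says that rho stays away from vacuum. *)
Record Chapman_Enskog (dens : R -> Prop) (bh q : R -> R) (V : R -> R -> R)
    (Omega K : R -> R -> Prop) (eps0 : R) (rho v w v1 : family) : Prop := {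
  ce_open : forall t x, Omega t x -> locally_2d Omega t x;
  ce_sub : forall t x, K t x -> Omega t x;
  ce_eps0 : 0 < eps0;
  ce_smooth : forall eps, 0 < eps < eps0 ->
    smooth2 Omega (rho eps) /\ smooth2 Omega (v eps) /\ smooth2 Omega (w eps);
  ce_pos : forall eps, 0 < eps < eps0 -> forall t x, Omega t x ->
    0 < rho eps t x /\ dens (rho eps t x);
  ce_solves : forall eps, 0 < eps < eps0 ->
    solves_A bh q V eps Omega (rho eps) (v eps) (w eps);
  ce_rho : bigO Omega K eps0 0 rho;
  ce_h : bigO Omega K eps0 0 (fun eps => h_of bh (rho eps) (w eps));
  ce_v1 : bigO Omega K eps0 0 v1;
  ce_compact : exists a b delta : R, 0 < delta /\
    (forall r, a <= r <= b -> dens r) /\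
    forall eps, 0 < eps < delta -> eps < eps0 -> forall t x, K t x ->
      a <= rho eps t x <= b;
  ce_expansion : bigO Omega K eps0 2 (fun eps t x =>
    v eps t x - (V_of bh V (rho eps) (w eps) t x + eps * v1 eps t x))
}.

(* Left-hand side of the equilibrium equation for the conserved quantity u. *)
Definition equilibrium_lhs (bh : R -> R) (V : R -> R -> R) (rho w u : field)
  : field :=
  fun t x => Dt u t x + Dx (fun t x => V_of bh V rho w t x * u t x) t x.

Definition diffusive_flux (bh : R -> R) (mu : R -> R -> mat2) (rho w : field)
    (t x : R) : vec2 :=
  matvec (mu (rho t x) (h_of bh rho w t x))
         (Dx rho t x, Dx (h_of bh rho w) t x).

(* Inserting the Chapman-Enskog expansion into (A) gives
   (rho, w)_t + (V_C rho, V_C w)_x = - eps (mu (rho, h)_x)_x + O(eps^2). *)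
Definition first_order_correction (dens : R -> Prop) (bh q : R -> R)
    (V : R -> R -> R) (mu : R -> R -> mat2) : Prop :=
  forall (Omega K : R -> R -> Prop) (eps0 : R) (rho v w v1 : family),
    Chapman_Enskog dens bh q V Omega K eps0 rho v w v1 ->
    bigO Omega K eps0 2 (fun eps t x =>
      equilibrium_lhs bh V (rho eps) (w eps) (rho eps) t x
      - - eps * Dx (fun t x =>
                      fst (diffusive_flux bh mu (rho eps) (w eps) t x)) t x) /\
    bigO Omega K eps0 2 (fun eps t x =>
      equilibrium_lhs bh V (rho eps) (w eps) (w eps) t x
      - - eps * Dx (fun t x =>
                      snd (diffusive_flux bh mu (rho eps) (w eps) t x)) t x).

Definition coincides_with_equilibrium (dens : R -> Prop) (bh q : R -> R)
    (V : R -> R -> R) : Prop :=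
  forall (Omega K : R -> R -> Prop) (eps0 : R) (rho v w v1 : family),
    Chapman_Enskog dens bh q V Omega K eps0 rho v w v1 ->
    bigO Omega K eps0 2 (fun eps =>
      equilibrium_lhs bh V (rho eps) (w eps) (rho eps)) /\
    bigO Omega K eps0 2 (fun eps =>
      equilibrium_lhs bh V (rho eps) (w eps) (w eps)).

(* Main.v *)
Require Import Defs.
From Stdlib Require Import Reals Lra ClassicalEpsilon.
From Coquelicot Require Import Coquelicot.
(* The real number library has its own [family] and [Dx]; the names below are
   those of the model. *)
Import Defs.
Open Scope R_scope.

(** Why the theorem holds.  Write D = v - V_C(rho, h) for the deviation from
    equilibrium, c for the scalar factor of the diffusion matrix and
    G = d_rho V_C + bh'(rho) d_h V_C.  The first and third equations of (A)
    give h_t = bh'(rho) rho_t - v (h_x - bh'(rho) rho_x), so that the chain rule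
    turns the t-derivative of V_C(rho, h) into
      (V_C)_t = - v (V_C)_x - rho G v_x.
    Substituting v = V_C + D in the relaxation equation then yields the exact
    identity
      D = eps (c (V_C)_x - E),   E = D_t + (v - rho G - q'(h) bh'(rho) rho) D_x
    ([deviation_expansion]).  The expansion v = V_C + eps v1 + O(eps^2) gives
    D = O(eps), hence E = O(eps).  For a conserved quantity u, that is
    u_t + (u v)_x = 0, this reads
      u_t + (V_C u)_x = - (u D)_x = - eps (u c (V_C)_x)_x + eps (u E)_x,
    and the last term is O(eps^2) ([conserved_quantity_correction]).  For
    u = rho and u = w the flux u c (V_C)_x is the corresponding component of
    mu_C (rho_x, h_x).  Under the relation of the second part c = 0, hence the
    flux vanishes.

    The analytic content is that the symbol O(eps^k), which bounds all the
    derivatives, is stable under sums, products, differentiation and composition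
    with smooth functions.  An induction needs f_t and f_x to play the same role,
    which the derivatives d_t^i d_x^j, taken first in x, do not give.  So O(eps^k)
    is first reformulated by recursion: f is of that size, and so are f_t and f_x,
    and so on to any depth ([controlled]).  By Schwarz's theorem this is
    equivalent ([bigO_controlled], [controlled_bigO]), and each stability property
    becomes a short induction on the depth.  For compositions F(rho, h) the base case is the boundedness of a
    continuous function on a compact rectangle ([continuity_2d_bounded]). *)

(** * Functions of two variables *)

Lemma C1_differentiable (F : R -> R -> R) (r h : R) :
  locally_2d (fun u v => ex_derive (fun s => F s v) u) r h ->
  ex_derive (fun s => F r s) h ->
  continuity_2d_pt (d_rho F) r h ->
  differentiable_pt_lim F r h (d_rho F r h) (d_h F r h).
Proof.
intros Hr Hh Hc.
apply filterdiff_differentiable_pt_lim.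
apply (is_derive_filterdiff F r h (d_rho F) (d_h F r h)).
- apply locally_2d_locally in Hr; revert Hr; apply filter_imp.
  intros [u v] Hu; simpl in *; now apply Derive_correct.
- now apply Derive_correct.
- now apply continuity_2d_pt_filterlim in Hc.
Qed.

Lemma continuity_2d_pt_comp (F g1 g2 : R -> R -> R) (t x : R) :
  continuity_2d_pt F (g1 t x) (g2 t x) ->
  continuity_2d_pt g1 t x -> continuity_2d_pt g2 t x ->
  continuity_2d_pt (fun u v => F (g1 u v) (g2 u v)) t x.
Proof.
intros HF H1 H2 eps.
destruct (HF eps) as [d Hd].
destruct (locally_2d_and _ _ _ _ (H1 d) (H2 d)) as [e He].
exists e; intros u v Hu Hv.
now apply Hd; apply He.
Qed.

(** Around each point F is bounded by the inverse of the size of a suitable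
    square, so a positive lower bound on the sizes of the squares of a cover of
    the rectangle is an upper bound for F. *)
Lemma continuity_2d_bounded (F : R -> R -> R) (a b c d : R) :
  (forall r h, a <= r <= b -> c <= h <= d -> continuity_2d_pt F r h) ->
  exists M, forall r h, a <= r <= b -> c <= h <= d -> Rabs (F r h) <= M.
Proof.
intros HF.
(* The single number e serves as the size of the square and as the inverse of
   the bound, hence the minimum with 1 / (|F r h| + 1) below. *)
assert (Hsel : forall r h, exists e : posreal, a <= r <= b -> c <= h <= d ->
  forall u v, Rabs (u - r) < e -> Rabs (v - h) < e -> Rabs (F u v) <= / e).
{ intros r h.
  destruct (excluded_middle_informative (a <= r <= b /\ c <= h <= d))
    as [[Hr Hh] | Hn].
  2: { exists (mkposreal 1 Rlt_0_1); tauto. }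
  destruct (HF r h Hr Hh (mkposreal 1 Rlt_0_1)) as [e1 He1]; simpl in He1.
  assert (Hp : 0 < / (Rabs (F r h) + 1)).
  { apply Rinv_0_lt_compat; generalize (Rabs_pos (F r h)); lra. }
  assert (Hm : 0 < Rmin e1 (/ (Rabs (F r h) + 1))).
  { apply Rmin_pos; [apply cond_pos | exact Hp]. }
  exists (mkposreal _ Hm); intros _ _ u v Hu Hv; simpl in *.
  assert (H : Rabs (F u v - F r h) < 1).
  { apply He1; (eapply Rlt_le_trans; [eassumption | apply Rmin_l]). }
  apply Rle_trans with (Rabs (F r h) + 1).
  - replace (F u v) with (F r h + (F u v - F r h)) by ring.
    eapply Rle_trans; [apply Rabs_triang | lra].
  - rewrite <- (Rinv_inv (Rabs (F r h) + 1)) at 1.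
    apply Rinv_le_contravar; [exact Hm | apply Rmin_r]. }
pose (delta := fun r h =>
  proj1_sig (constructive_indefinite_description _ (Hsel r h))).
destruct (compactness_value_2d a b c d delta) as [e He].
exists (/ e); intros r h Hr Hh.
apply Rnot_lt_le; intros Hlt.
apply (He r h Hr Hh); intros (u & v & Hu & Hv & H1 & H2 & H3).
assert (Hb : Rabs (F r h) <= / delta u v).
{ unfold delta in *; destruct (constructive_indefinite_description _ _)
    as [e' He']; simpl in *.
  now apply He'. }
assert (/ delta u v <= / e).
{ apply Rinv_le_contravar; [apply cond_pos | exact H3]. }
lra.
Qed.

(** * Calculus of the symbol O(eps^k) *)

Section Symbols.

Variables (Omega K : R -> R -> Prop) (eps0 : R).
Hypothesis Omega_open : forall t x, Omega t x -> locally_2d Omega t x.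
Hypothesis K_sub : forall t x, K t x -> Omega t x.

Definition on_Omega (P : R -> R -> R -> Prop) : Prop :=
  forall eps, 0 < eps < eps0 -> forall t x, Omega t x -> P eps t x.

Definition eventually_on_K (P : R -> R -> R -> Prop) : Prop :=
  exists delta, 0 < delta /\
    forall eps, 0 < eps < delta -> eps < eps0 -> forall t x, K t x -> P eps t x.

Definition order_on_K (k : nat) (f : family) : Prop :=
  exists C, eventually_on_K (fun eps t x => Rabs (f eps t x) <= C * eps ^ k).

(** The symbol O(eps^k) for f and for its derivatives up to order n, where the
    derivatives in t and x may be taken in any order. *)
Fixpoint controlled (n k : nat) (f : family) : Prop :=
  on_Omega (fun eps => continuity_2d_pt (f eps)) /\ order_on_K k f /\
  match n with
  | O => True
  | S n =>
      on_Omega (fun eps t x => ex_derive (fun s => f eps s x) t /\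
                               ex_derive (fun y => f eps t y) x) /\
      controlled n k (fun eps => Dt (f eps)) /\
      controlled n k (fun eps => Dx (f eps))
  end.

Lemma eventually_and (P Q : R -> R -> R -> Prop) :
  eventually_on_K P -> eventually_on_K Q ->
  eventually_on_K (fun eps t x => P eps t x /\ Q eps t x).
Proof.
intros (d & Hd & HP) (e & He & HQ).
exists (Rmin d e); split; [now apply Rmin_pos |].
intros eps Heps Heps0 t x Hx.
generalize (Rmin_l d e) (Rmin_r d e); intros.
split; [apply HP | apply HQ]; auto; lra.
Qed.

Lemma eventually_imp (P Q : R -> R -> R -> Prop) :
  (forall eps t x, 0 < eps < eps0 -> K t x -> P eps t x -> Q eps t x) ->
  eventually_on_K P -> eventually_on_K Q.
Proof.
intros HPQ (d & Hd & HP); exists d; split; [exact Hd |].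
intros eps Heps Heps0 t x Hx; apply HPQ; auto; lra.
Qed.

(** A sign for the constant is what allows bounds to be multiplied. *)
Lemma order_on_K_nonneg (k : nat) (f : family) :
  order_on_K k f -> exists C, 0 <= C /\
    eventually_on_K (fun eps t x => Rabs (f eps t x) <= C * eps ^ k).
Proof.
intros (C & HC); exists (Rabs C); split; [apply Rabs_pos |].
revert HC; apply eventually_imp; intros eps t x Heps _ H.
eapply Rle_trans; [exact H |].
apply Rmult_le_compat_r; [apply pow_le; lra | apply Rle_abs].
Qed.

Lemma Derive_ext_Omega (f g : field) (t x : R) :
  (forall s y, Omega s y -> f s y = g s y) -> Omega t x ->
  Dt f t x = Dt g t x /\ Dx f t x = Dx g t x.
Proof.
intros H Hx; split; apply Derive_ext_loc;
  [generalize (locally_2d_1d_const_y _ _ _ (Omega_open t x Hx))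
  | generalize (locally_2d_1d_const_x _ _ _ (Omega_open t x Hx))];
  apply filter_imp; auto.
Qed.

Lemma controlled_ext (n k : nat) (f g : family) :
  on_Omega (fun eps t x => f eps t x = g eps t x) ->
  controlled n k f -> controlled n k g.
Proof.
revert f g; induction n as [|n IH]; intros f g E (Hc & (C & HC) & H);
  (split; [|split]).
1, 4: intros eps Heps t x Hx; apply continuity_2d_pt_ext_loc with (f eps);
  [ destruct (Omega_open t x Hx) as [d Hd]; exists d; intros; apply E; auto
  | now apply Hc].
1, 3: exists C; revert HC; apply eventually_imp; intros eps t x Heps Hx;
  rewrite E; auto.
exact I.
destruct H as (Hd & Ht & Hx').
split; [|split].
- intros eps Heps t x Hx; destruct (Hd eps Heps t x Hx) as [H1 H2].
  split.
  + apply (ex_derive_ext_loc (fun s => f eps s x)); [|exact H1].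
    generalize (locally_2d_1d_const_y _ _ _ (Omega_open t x Hx)).
    apply filter_imp; intros; now apply E.
  + apply (ex_derive_ext_loc (fun y => f eps t y)); [|exact H2].
    generalize (locally_2d_1d_const_x _ _ _ (Omega_open t x Hx)).
    apply filter_imp; intros; now apply E.
- revert Ht; apply IH; intros eps Heps t x Hx.
  apply Derive_ext_Omega; [now apply E | exact Hx].
- revert Hx'; apply IH; intros eps Heps t x Hx.
  apply Derive_ext_Omega; [now apply E | exact Hx].
Qed.

Lemma controlled_pred (n k : nat) (f : family) :
  controlled (S n) k f -> controlled n k f.
Proof.
revert f; induction n as [|n IH]; intros f (Hc & Ho & Hd & Ht & Hx).
- now repeat split.
- split; [exact Hc | split; [exact Ho | split; [exact Hd |]]].
  split; now apply IH.
Qed.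

Lemma controlled_const (k : nat) (a : R -> R) (C : R) (n : nat) :
  (forall eps, 0 < eps -> Rabs (a eps) <= C * eps ^ k) ->
  controlled n k (fun eps _ _ => a eps).
Proof.
revert a C; induction n as [|n IH]; intros a C Ha; (split; [|split]).
1, 4: intros eps _ t x _; apply continuity_2d_pt_const.
1, 3: exists C, 1; split; [lra | intros; apply Ha; lra].
exact I.
split; [|split].
- intros eps _ t x _; split; apply ex_derive_const.
- apply controlled_ext with (fun _ _ _ => 0).
  + intros eps _ t x _; unfold Dt; now rewrite Derive_const.
  + apply (IH _ 0); intros; rewrite Rabs_R0; lra.
- apply controlled_ext with (fun _ _ _ => 0).
  + intros eps _ t x _; unfold Dx; now rewrite Derive_const.
  + apply (IH _ 0); intros; rewrite Rabs_R0; lra.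
Qed.

Lemma controlled_plus (n k : nat) (f g : family) :
  controlled n k f -> controlled n k g ->
  controlled n k (fun eps t x => f eps t x + g eps t x).
Proof.
revert f g; induction n as [|n IH];
  intros f g (Hcf & (C & HC) & Hf) (Hcg & (D & HD) & Hg); (split; [|split]).
1, 4: intros eps Heps t x Hx; apply continuity_2d_pt_plus;
  [now apply Hcf | now apply Hcg].
1, 3: exists (C + D); generalize (eventually_and _ _ HC HD);
  apply eventually_imp; intros eps t x _ _ [H1 H2];
  eapply Rle_trans; [apply Rabs_triang | lra].
exact I.
destruct Hf as (Hdf & Htf & Hxf), Hg as (Hdg & Htg & Hxg).
split; [|split].
- intros eps Heps t x Hx.
  destruct (Hdf eps Heps t x Hx), (Hdg eps Heps t x Hx).
  split; [ apply (ex_derive_plus (fun s => f eps s x) (fun s => g eps s x))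
         | apply (ex_derive_plus (fun y => f eps t y) (fun y => g eps t y)) ];
    assumption.
- refine (controlled_ext _ _ _ _ _ (IH _ _ Htf Htg)).
  intros eps Heps t x Hx.
  destruct (Hdf eps Heps t x Hx), (Hdg eps Heps t x Hx).
  symmetry; now apply Derive_plus.
- refine (controlled_ext _ _ _ _ _ (IH _ _ Hxf Hxg)).
  intros eps Heps t x Hx.
  destruct (Hdf eps Heps t x Hx), (Hdg eps Heps t x Hx).
  symmetry; now apply Derive_plus.
Qed.

Lemma controlled_mult (n k l : nat) (f g : family) :
  controlled n k f -> controlled n l g ->
  controlled n (k + l) (fun eps t x => f eps t x * g eps t x).
Proof.
revert f g; induction n as [|n IH];
  intros f g Hf Hg; generalize Hf Hg;
  intros (Hcf & Hof & Hf') (Hcg & Hog & Hg'); (split; [|split]).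
1, 4: intros eps Heps t x Hx; apply continuity_2d_pt_mult;
  [now apply Hcf | now apply Hcg].
1, 3: destruct (order_on_K_nonneg _ _ Hof) as (C & HC0 & HC);
  destruct (order_on_K_nonneg _ _ Hog) as (D & HD0 & HD);
  exists (C * D); generalize (eventually_and _ _ HC HD);
  apply eventually_imp; intros eps t x _ _ [H1 H2];
  rewrite Rabs_mult, pow_add;
  replace (C * D * (eps ^ k * eps ^ l))
    with ((C * eps ^ k) * (D * eps ^ l)) by ring;
  apply Rmult_le_compat; auto using Rabs_pos.
exact I.
destruct Hf' as (Hdf & Htf & Hxf), Hg' as (Hdg & Htg & Hxg).
apply controlled_pred in Hf, Hg.
split; [|split].
- intros eps Heps t x Hx.
  destruct (Hdf eps Heps t x Hx), (Hdg eps Heps t x Hx).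
  split; now apply ex_derive_mult.
- refine (controlled_ext _ _ _ _ _
    (controlled_plus _ _ _ _ (IH _ _ Htf Hg) (IH _ _ Hf Htg))).
  intros eps Heps t x Hx.
  destruct (Hdf eps Heps t x Hx), (Hdg eps Heps t x Hx).
  symmetry; unfold Dt; now rewrite Derive_mult.
- refine (controlled_ext _ _ _ _ _
    (controlled_plus _ _ _ _ (IH _ _ Hxf Hg) (IH _ _ Hf Hxg))).
  intros eps Heps t x Hx.
  destruct (Hdf eps Heps t x Hx), (Hdg eps Heps t x Hx).
  symmetry; unfold Dx; now rewrite Derive_mult.
Qed.

Lemma is_derive_comp_2d (F : R -> R -> R) (f g : R -> R) (s : R) :
  locally_2d (fun u v => ex_diff_n F 1 u v) (f s) (g s) ->
  ex_derive f s -> ex_derive g s ->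
  is_derive (fun z => F (f z) (g z)) s
    (d_rho F (f s) (g s) * Derive f s + d_h F (f s) (g s) * Derive g s).
Proof.
intros HF Hf Hg.
apply is_derive_Reals, derivable_pt_lim_comp_2d.
- generalize (locally_2d_singleton _ _ _ HF); intros (_ & _ & H2 & [H3 _] & _).
  apply C1_differentiable; auto.
  revert HF; apply locally_2d_impl, locally_2d_forall.
  intros u v (_ & H & _); exact H.
- now apply is_derive_Reals, Derive_correct.
- now apply is_derive_Reals, Derive_correct.
Qed.

(** By the chain rule the derivatives of F(f, g) are sums of products of
    derivatives of f or g with compositions of derivatives of F; the induction
    therefore runs over all smooth F at once. *)
Lemma controlled_comp (D : R -> R -> Prop) (a b c d : R) (f g : family)
    (n : nat) (F : R -> R -> R) :
  (forall r h, D r h -> locally_2d D r h) ->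
  (forall r h, a <= r <= b -> c <= h <= d -> D r h) ->
  on_Omega (fun eps t x => D (f eps t x) (g eps t x)) ->
  eventually_on_K (fun eps t x => a <= f eps t x <= b /\ c <= g eps t x <= d) ->
  smooth2 D F -> controlled n 0 f -> controlled n 0 g ->
  controlled n 0 (fun eps t x => F (f eps t x) (g eps t x)).
Proof.
intros HD Hbox HDfg HK.
revert F; induction n as [|n IH]; intros F HF Hf Hg; generalize Hf Hg;
  intros (Hcf & _ & Hf') (Hcg & _ & Hg'); (split; [|split]).
1, 4: intros eps Heps t x Hx; apply continuity_2d_pt_comp;
  [ apply (HF 0%nat); now apply HDfg | now apply Hcf | now apply Hcg ].
1, 3: destruct (continuity_2d_bounded F a b c d) as [M HM];
  [ intros r h Hr Hh; apply (HF 0%nat); auto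
  | exists M; revert HK; apply eventually_imp; intros eps t x _ _ [H1 H2];
    rewrite Rmult_1_r; auto ].
exact I.
destruct Hf' as (Hdf & Htf & Hxf), Hg' as (Hdg & Htg & Hxg).
apply controlled_pred in Hf, Hg.
assert (Hloc : forall r h, D r h -> locally_2d (ex_diff_n F 1) r h).
{ intros r h Hrh; destruct (HD r h Hrh) as [e He].
  exists e; intros; apply HF; auto. }
assert (HF1 : smooth2 D (d_rho F)) by (intros m r h Hrh; now apply (HF (S m))).
assert (HF2 : smooth2 D (d_h F)) by (intros m r h Hrh; now apply (HF (S m))).
split; [|split].
- intros eps Heps t x Hx.
  destruct (Hdf eps Heps t x Hx), (Hdg eps Heps t x Hx).
  split; eexists; apply is_derive_comp_2d; auto; apply Hloc, HDfg; auto.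
- refine (controlled_ext _ _ _ _ _ (controlled_plus _ _ _ _
    (controlled_mult _ 0 0 _ _ (IH _ HF1 Hf Hg) Htf)
    (controlled_mult _ 0 0 _ _ (IH _ HF2 Hf Hg) Htg))).
  intros eps Heps t x Hx.
  destruct (Hdf eps Heps t x Hx), (Hdg eps Heps t x Hx).
  symmetry; apply is_derive_unique.
  apply (is_derive_comp_2d F (fun s => f eps s x) (fun s => g eps s x));
    auto; apply Hloc, HDfg; auto.
- refine (controlled_ext _ _ _ _ _ (controlled_plus _ _ _ _
    (controlled_mult _ 0 0 _ _ (IH _ HF1 Hf Hg) Hxf)
    (controlled_mult _ 0 0 _ _ (IH _ HF2 Hf Hg) Hxg))).
  intros eps Heps t x Hx.
  destruct (Hdf eps Heps t x Hx), (Hdg eps Heps t x Hx).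
  symmetry; apply is_derive_unique.
  apply (is_derive_comp_2d F (fun y => f eps t y) (fun y => g eps t y));
    auto; apply Hloc, HDfg; auto.
Qed.

Lemma locally_Omega (P : R -> R -> Prop) (t x : R) :
  (forall s y, Omega s y -> P s y) -> Omega t x -> locally_2d P t x.
Proof.
intros HP Hx; destruct (Omega_open t x Hx) as [d Hd].
exists d; auto.
Qed.

Lemma bigO_Dx (k : nat) (f : family) :
  bigO Omega K eps0 k f -> bigO Omega K eps0 k (fun eps => Dx (f eps)).
Proof.
intros [Hs Hb]; split.
- intros eps Heps n t x Hx; now apply (Hs eps Heps (S n)).
- intros i j; destruct (Hb i (S j)) as (C & d & Hd & H).
  exists C, d; split; [exact Hd |].
  intros eps He He0 t x Hx; rewrite <- (Nat.add_1_r j), <- (Nat.add_0_r i) in H.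
  specialize (H eps He He0 t x Hx).
  rewrite <- partial_derive_add_zero in H by auto; exact H.
Qed.

(** In [partial_derive i j] the derivatives in x come first, so here d_t has to
    be moved past d_x^j, which is Schwarz's theorem. *)
Lemma bigO_Dt (k : nat) (f : family) :
  bigO Omega K eps0 k f -> bigO Omega K eps0 k (fun eps => Dt (f eps)).
Proof.
intros [Hs Hb]; split.
- intros eps Heps n t x Hx; now apply (Hs eps Heps (S n)).
- intros i j; destruct (Hb (S i) j) as (C & d & Hd & H).
  exists C, d; split; [exact Hd |].
  intros eps He He0 t x Hx.
  rewrite <- (Nat.add_1_r i) in H.
  specialize (H eps He He0 t x Hx).
  change j with (0 + j)%nat in H at 1.
  rewrite <- partial_derive_add_zero in H by auto.
  replace (partial_derive i j (Dt (f eps)) t x)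
    with (partial_derive i 0 (partial_derive 1 j (f eps)) t x); [exact H |].
  apply Derive_n_ext_loc.
  generalize (locally_2d_1d_const_y _ _ _ (Omega_open t x (K_sub t x Hx))).
  apply filter_imp; intros s Hsx.
  apply (Derive_partial_derive_aux1 j (f eps)).
  apply locally_Omega; [|exact Hsx].
  intros; apply Hs; auto; lra.
Qed.

Lemma bigO_controlled (k : nat) (f : family) :
  bigO Omega K eps0 k f -> forall n, controlled n k f.
Proof.
intros H n; revert f H; induction n as [|n IH]; intros f H; generalize H;
  intros [Hs Hb]; (split; [|split]).
1, 4: intros eps Heps t x Hx; now apply (Hs eps Heps 0%nat).
1, 3: exact (Hb 0%nat 0%nat).
exact I.
split; [|split].
- intros eps Heps t x Hx.
  destruct (Hs eps Heps 1%nat t x Hx) as (_ & H1 & H2 & _); now split.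
- now apply IH, bigO_Dt.
- now apply IH, bigO_Dx.
Qed.

Lemma controlled_bigO (k : nat) (f : family) :
  (forall n, controlled n k f) -> bigO Omega K eps0 k f.
Proof.
intros H; split.
- intros eps Heps n t x Hx; generalize (H n); clear H; revert f.
  induction n as [|n IH]; intros f (Hc & _ & H).
  + split; [now apply Hc | exact I].
  + destruct H as (Hd & Ht & Hx').
    split; [now apply Hc |].
    destruct (Hd eps Heps t x Hx) as [H1 H2].
    split; [exact H1 | split; [exact H2 | split]].
    * exact (IH _ Ht).
    * exact (IH _ Hx').
- intros i j; generalize (H (i + j)%nat); clear H.
  revert f; induction j as [|j IHj]; [induction i as [|i IHi] |]; intros f H.
  + exact (proj1 (proj2 H)).
  + destruct H as (_ & _ & _ & H & _).
    destruct (IHi _ H) as (C & d & Hd & HC); exists C, d; split; [exact Hd |].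
    intros eps He He0 t x Hx.
    rewrite <- (Nat.add_1_r i), <- (Nat.add_0_r 0), <- partial_derive_add_zero
      by auto.
    now apply HC.
  + rewrite Nat.add_succ_r in H; destruct H as (_ & _ & _ & _ & H).
    destruct (IHj _ H) as (C & d & Hd & HC); exists C, d; split; [exact Hd |].
    intros eps He He0 t x Hx.
    rewrite <- (Nat.add_1_r j), <- (Nat.add_0_r i), <- partial_derive_add_zero
      by auto.
    now apply HC.
Qed.

Lemma bigO_ext (k : nat) (f g : family) :
  on_Omega (fun eps t x => f eps t x = g eps t x) ->
  bigO Omega K eps0 k f -> bigO Omega K eps0 k g.
Proof.
intros E H; apply controlled_bigO; intros n.
now apply controlled_ext with f, bigO_controlled.
Qed.

Lemma bigO_plus (k : nat) (f g : family) :
  bigO Omega K eps0 k f -> bigO Omega K eps0 k g ->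
  bigO Omega K eps0 k (fun eps t x => f eps t x + g eps t x).
Proof.
intros Hf Hg; apply controlled_bigO; intros n.
now apply controlled_plus; apply bigO_controlled.
Qed.

Lemma bigO_mult (k l : nat) (f g : family) :
  bigO Omega K eps0 k f -> bigO Omega K eps0 l g ->
  bigO Omega K eps0 (k + l) (fun eps t x => f eps t x * g eps t x).
Proof.
intros Hf Hg; apply controlled_bigO; intros n.
now apply controlled_mult; apply bigO_controlled.
Qed.

Lemma bigO_const (c : R) : bigO Omega K eps0 0 (fun _ _ _ => c).
Proof.
apply controlled_bigO; intros n.
apply (controlled_const 0 (fun _ => c) (Rabs c)); intros; simpl; lra.
Qed.

Lemma bigO_eps : bigO Omega K eps0 1 (fun eps _ _ => eps).
Proof.
apply controlled_bigO; intros n.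
apply (controlled_const 1 (fun eps => eps) 1); intros.
rewrite Rabs_pos_eq; lra.
Qed.

Lemma bigO_minus (k : nat) (f g : family) :
  bigO Omega K eps0 k f -> bigO Omega K eps0 k g ->
  bigO Omega K eps0 k (fun eps t x => f eps t x - g eps t x).
Proof.
intros Hf Hg.
apply bigO_ext with (fun eps t x => f eps t x + -1 * g eps t x).
- intros eps _ t x _; ring.
- apply bigO_plus; [exact Hf |].
  exact (bigO_mult 0 k _ _ (bigO_const (-1)) Hg).
Qed.

Lemma bigO_weaken (k : nat) (f : family) :
  bigO Omega K eps0 (S k) f -> bigO Omega K eps0 k f.
Proof.
intros [Hs Hb]; split; [exact Hs |].
intros i j; destruct (Hb i j) as (C & d & Hd & H).
exists (Rabs C), (Rmin d 1); split; [apply Rmin_pos; lra |].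
intros eps He He0 t x Hx.
generalize (Rmin_l d 1) (Rmin_r d 1); intros.
apply Rle_trans with (1 := H eps ltac:(lra) He0 t x Hx); simpl.
rewrite (Rmult_comm eps), <- Rmult_assoc.
assert (Hp : 0 <= eps ^ k) by (apply pow_le; lra).
apply Rle_trans with (Rabs C * eps ^ k * eps).
- apply Rmult_le_compat_r; [lra |].
  apply Rmult_le_compat_r; [exact Hp | apply Rle_abs].
- rewrite <- (Rmult_1_r (Rabs C * eps ^ k)) at 2.
  apply Rmult_le_compat_l; [|lra].
  apply Rmult_le_pos; [apply Rabs_pos | exact Hp].
Qed.

Lemma bigO_ex_derive (k : nat) (f : family) (eps t x : R) :
  bigO Omega K eps0 k f -> 0 < eps < eps0 -> Omega t x ->
  ex_derive (fun s => f eps s x) t /\ ex_derive (fun y => f eps t y) x.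
Proof.
intros [Hs _] He Hx.
destruct (Hs eps He 1%nat t x Hx) as (_ & H1 & H2 & _); now split.
Qed.

Lemma bigO_bounded (f : family) :
  bigO Omega K eps0 0 f ->
  exists M, eventually_on_K (fun eps t x => - M <= f eps t x <= M).
Proof.
intros [_ Hb]; destruct (Hb 0%nat 0%nat) as (C & d & Hd & H).
exists C, d; split; [exact Hd |].
intros eps He He0 t x Hx; apply Rabs_le_between.
generalize (H eps He He0 t x Hx); simpl; now rewrite Rmult_1_r.
Qed.

Lemma bigO_comp (D : R -> R -> Prop) (a b c d : R) (f g : family)
    (F : R -> R -> R) :
  (forall r h, D r h -> locally_2d D r h) ->
  (forall r h, a <= r <= b -> c <= h <= d -> D r h) ->
  on_Omega (fun eps t x => D (f eps t x) (g eps t x)) ->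
  eventually_on_K (fun eps t x => a <= f eps t x <= b /\ c <= g eps t x <= d) ->
  smooth2 D F -> bigO Omega K eps0 0 f -> bigO Omega K eps0 0 g ->
  bigO Omega K eps0 0 (fun eps t x => F (f eps t x) (g eps t x)).
Proof.
intros HD Hbox HDfg HK HF Hf Hg; apply controlled_bigO; intros n.
now apply controlled_comp with D a b c d; try apply bigO_controlled.
Qed.

End Symbols.

Arguments bigO_ext {Omega K eps0} _ _ {k f g} _ _.
Arguments bigO_plus {Omega K eps0} _ _ {k f g} _ _.
Arguments bigO_minus {Omega K eps0} _ _ {k f g} _ _.
Arguments bigO_mult {Omega K eps0} _ _ {k l f g} _ _.
Arguments bigO_eps {Omega K eps0} _ _.
Arguments bigO_weaken {Omega K eps0 k f} _.
Arguments bigO_Dt {Omega K eps0} _ _ {k f} _.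
Arguments bigO_Dx {Omega K eps0 k f} _.
Arguments bigO_ex_derive {Omega K eps0 k f eps t x} _ _ _.
Arguments bigO_bounded {Omega K eps0 f} _.
Arguments Derive_ext_Omega {Omega} _ {f g t x} _ _.

(** * Composition with the functions of the model *)

Lemma open_cylinder (D : R -> Prop) (r h : R) :
  open D -> D r -> locally_2d (fun u _ => D u) r h.
Proof.
intros HD Hr; destruct (HD r Hr) as [e He].
exists e; intros u v Hu _; now apply He.
Qed.

Lemma smooth1_Derive (D : R -> Prop) (g : R -> R) :
  smooth1 D g -> smooth1 D (Derive g).
Proof.
intros Hg [|n] r Hr; [exact I |].
apply ex_derive_ext with (Derive_n g (S n)).
- intros s; rewrite <- (Nat.add_1_r n); symmetry; apply (Derive_n_comp g n 1).
- exact (Hg (S (S n)) r Hr).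
Qed.

(** Functions of one variable are treated as functions of (r, h), so that one
    composition lemma covers V, bh and q. *)
Lemma smooth2_fst (D : R -> Prop) (g : R -> R) :
  smooth1 D g -> smooth2 (fun r _ => D r) (fun r _ => g r).
Proof.
intros Hg n; revert g Hg; induction n as [|n IH]; intros g Hg r h Hr;
  (split; [|]).
1, 3: apply (continuity_1d_2d_pt_comp g (fun u _ => u));
  [ apply continuity_pt_filterlim, (ex_derive_continuous g), (Hg 1%nat r Hr)
  | apply continuity_2d_pt_id1 ].
exact I.
split; [exact (Hg 1%nat r Hr) |].
split; [apply ex_derive_const |].
split; [now apply (IH (Derive g)); [apply smooth1_Derive |] |].
apply ex_diff_n_ext_loc with (fun _ _ => 0).
- apply locally_2d_forall; intros; symmetry; apply Derive_const.
- apply (IH (fun _ => 0)); [|exact Hr].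
  intros m s _; apply ex_derive_n_const.
Qed.

Lemma bigO_comp_1d (Omega K : R -> R -> Prop) (eps0 : R) (D : R -> Prop)
    (a b : R) (f : family) (g : R -> R) :
  (forall t x, Omega t x -> locally_2d Omega t x) ->
  (forall t x, K t x -> Omega t x) ->
  open D -> (forall r, a <= r <= b -> D r) ->
  on_Omega Omega eps0 (fun eps t x => D (f eps t x)) ->
  eventually_on_K K eps0 (fun eps t x => a <= f eps t x <= b) ->
  smooth1 D g -> bigO Omega K eps0 0 f ->
  bigO Omega K eps0 0 (fun eps t x => g (f eps t x)).
Proof.
intros HO HK HD Hab HDf HKf Hg Hf.
apply (bigO_comp Omega K eps0 HO HK (fun r _ => D r) a b a b f f
  (fun r _ => g r)); auto.
- intros r h; now apply open_cylinder.
- now apply eventually_and.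
- now apply smooth2_fst.
Qed.

Lemma chain_rule (D : R -> Prop) (F : R -> R -> R) (f g : R -> R) (s : R) :
  open D -> smooth2 (fun r _ => D r) F -> D (f s) ->
  ex_derive f s -> ex_derive g s ->
  Derive (fun z => F (f z) (g z)) s
    = d_rho F (f s) (g s) * Derive f s + d_h F (f s) (g s) * Derive g s.
Proof.
intros HD HF Hs Hf Hg; apply is_derive_unique, is_derive_comp_2d; auto.
generalize (open_cylinder D (f s) (g s) HD Hs).
apply locally_2d_impl, locally_2d_forall; intros u v Hu; now apply HF.
Qed.

Arguments ce_open {dens bh q V Omega K eps0 rho v w v1} _.
Arguments ce_sub {dens bh q V Omega K eps0 rho v w v1} _.
Arguments ce_smooth {dens bh q V Omega K eps0 rho v w v1} _.
Arguments ce_pos {dens bh q V Omega K eps0 rho v w v1} _.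
Arguments ce_solves {dens bh q V Omega K eps0 rho v w v1} _.
Arguments ce_rho {dens bh q V Omega K eps0 rho v w v1} _.
Arguments ce_h {dens bh q V Omega K eps0 rho v w v1} _.
Arguments ce_v1 {dens bh q V Omega K eps0 rho v w v1} _.
Arguments ce_compact {dens bh q V Omega K eps0 rho v w v1} _.
Arguments ce_expansion {dens bh q V Omega K eps0 rho v w v1} _.

(** * The expansion along a family of solutions *)

Section Expansion.

Variables (dens : R -> Prop) (bh q : R -> R) (V : R -> R -> R).
Hypothesis dens_open : open dens.
Hypothesis bh_smooth : smooth1 dens bh.
Hypothesis q_smooth : smooth1 (fun _ => True) q.
Hypothesis V_smooth : smooth2 (fun r _ => dens r) V.

Variables (Omega K : R -> R -> Prop) (eps0 : R) (rho v w v1 : family).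
Hypothesis CE : Chapman_Enskog dens bh q V Omega K eps0 rho v w v1.

Definition hesitation : family := fun eps => h_of bh (rho eps) (w eps).

Local Notation h := hesitation.
Local Notation "'O(' k )" := (bigO Omega K eps0 k) (at level 0, k at level 99).

(** The density stays in a compact interval of the domain and h is bounded, so
    (rho, h) stays in a compact rectangle on which F and each of its derivatives
    are bounded. *)
Lemma bigO_along (F : R -> R -> R) :
  smooth2 (fun r _ => dens r) F ->
  O(0) (fun eps t x => F (rho eps t x) (h eps t x)).
Proof.
intros HF.
destruct (bigO_bounded (ce_h CE)) as [M HM].
destruct (ce_compact CE) as (a & b & d & Hd & Hab & Hr).
apply (bigO_comp Omega K eps0 (ce_open CE)
  (ce_sub CE) (fun r _ => dens r) a b (- M) M); auto.
- intros r y; now apply open_cylinder.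
- intros eps He t x Hx; now apply (ce_pos CE eps He t x).
- apply eventually_and; [now exists d | exact HM].
- exact (ce_rho CE).
- exact (ce_h CE).
Qed.

Lemma bigO_of_rho (g : R -> R) :
  smooth1 dens g -> O(0) (fun eps t x => g (rho eps t x)).
Proof.
intros Hg; now apply (bigO_along (fun r _ => g r)), smooth2_fst.
Qed.

Lemma bigO_of_h (g : R -> R) :
  smooth1 (fun _ => True) g -> O(0) (fun eps t x => g (h eps t x)).
Proof.
intros Hg.
destruct (bigO_bounded (ce_h CE)) as [M HM].
apply (bigO_comp_1d Omega K eps0 (fun _ => True) (- M) M); auto.
- exact (ce_open CE).
- exact (ce_sub CE).
- apply open_true.
- now intros eps He t x Hx.
- exact (ce_h CE).
Qed.

(** The relation between w and h, solved for w, has no division by rho: the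
    regularity and the bounds of w follow from those of rho and h. *)
Lemma w_of_h : on_Omega Omega eps0 (fun eps t x =>
  w eps t x = rho eps t x * (h eps t x - bh (rho eps t x))).
Proof.
intros eps He t x Hx; unfold hesitation, h_of.
generalize (proj1 (ce_pos CE eps He t x Hx)); intros.
field; lra.
Qed.

Lemma bigO_w : O(0) w.
Proof.
pose proof (ce_open CE) as HO; pose proof (ce_sub CE) as HK.
refine (bigO_ext HO HK _ (bigO_mult HO HK (ce_rho CE)
  (bigO_minus HO HK (ce_h CE) (bigO_of_rho bh bh_smooth)))).
intros eps He t x Hx; symmetry; now apply w_of_h.
Qed.

Definition equilibrium_velocity : family :=
  fun eps => V_of bh V (rho eps) (w eps).

Definition deviation : family := fun eps t x =>
  v eps t x - equilibrium_velocity eps t x.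

Lemma bigO_velocity : O(0) equilibrium_velocity.
Proof. exact (bigO_along V V_smooth). Qed.

Lemma bigO_deviation : O(1) deviation.
Proof.
pose proof (ce_open CE) as HO; pose proof (ce_sub CE) as HK.
refine (bigO_ext HO HK _ (bigO_plus HO HK
  (bigO_weaken (ce_expansion CE))
  (bigO_mult HO HK (bigO_eps HO HK) (ce_v1 CE)))).
intros eps _ t x _; unfold deviation, equilibrium_velocity; simpl; ring.
Qed.

Lemma Dx_velocity : on_Omega Omega eps0 (fun eps t x =>
  Dx (equilibrium_velocity eps) t x
  = d_rho V (rho eps t x) (h eps t x) * Dx (rho eps) t x
    + d_h V (rho eps t x) (h eps t x) * Dx (h eps) t x).
Proof.
intros eps He t x Hx.
apply (chain_rule dens V (fun y => rho eps t y) (fun y => h eps t y)); auto.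
- now apply (ce_pos CE).
- exact (proj2 (bigO_ex_derive (ce_rho CE) He Hx)).
- exact (proj2 (bigO_ex_derive (ce_h CE) He Hx)).
Qed.

(** The derivative of V along the curves h = bh(r) + const, on which w / rho is
    constant. *)
Definition equilibrium_slope (r y : R) : R :=
  d_rho V r y + Derive bh r * d_h V r y.

(** The scalar factor of the matrix [mu_C]; the relation between q, bh and V in
    the second part of the theorem says that it vanishes. *)
Definition flux_factor (r y : R) : R :=
  lambda1 bh V r y - (V r y - Derive q y * Derive bh r * r).

(** The term E of the identity D = eps (c (V_C)_x - E); it is of the size of the
    derivatives of D. *)
Definition remainder : family := fun eps t x =>
  let r := rho eps t x in
  Dt (deviation eps) t x
  + (v eps t x - r * equilibrium_slope r (h eps t x)
     - Derive q (h eps t x) * Derive bh r * r) * Dx (deviation eps) t x.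

Lemma bigO_remainder : O(1) remainder.
Proof.
pose proof (ce_open CE) as HO; pose proof (ce_sub CE) as HK.
pose proof (ce_rho CE) as Hr.
pose proof (bigO_of_rho _ (smooth1_Derive _ _ bh_smooth)) as Hb.
pose proof (bigO_of_h _ (smooth1_Derive _ _ q_smooth)) as Hq.
assert (Hv : O(0) v).
{ refine (bigO_ext HO HK _ (bigO_plus HO HK
    bigO_velocity (bigO_weaken bigO_deviation))).
  intros eps _ t x _; unfold deviation; ring. }
assert (Hs : O(0) (fun eps t x => equilibrium_slope (rho eps t x) (h eps t x))).
{ apply bigO_plus; auto.
  - apply bigO_along; intros n r y H; now apply (V_smooth (S n)).
  - apply (bigO_mult HO HK (k := 0) (l := 0)); [exact Hb |].
    apply bigO_along; intros n r y H; now apply (V_smooth (S n)). }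
apply bigO_plus; auto.
{ apply bigO_Dt; auto using bigO_deviation. }
apply (bigO_mult HO HK (k := 0) (l := 1));
  [| apply bigO_Dx, bigO_deviation].
repeat (apply bigO_minus || apply (bigO_mult HO HK (k := 0) (l := 0))); auto.
Qed.

(** The conservation laws make w / rho constant along the flow of v, which
    determines h_t and hence the t-derivative of the equilibrium velocity; the
    relaxation equation then expresses D in terms of x-derivatives and of the
    derivatives of D itself. *)
Lemma deviation_expansion : on_Omega Omega eps0 (fun eps t x =>
  deviation eps t x
  = eps * (flux_factor (rho eps t x) (h eps t x)
             * Dx (equilibrium_velocity eps) t x - remainder eps t x)).
Proof.
intros eps He t x Hx.
pose proof (ce_open CE) as HO.
destruct (ce_pos CE eps He t x Hx) as [Hpos Hdens].
destruct (ce_solves CE eps He t x Hx) as (E1 & E2 & E3).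
destruct (ce_smooth CE eps He) as (_ & Hv & _).
destruct (Hv 1%nat t x Hx) as (_ & vt & vx & _); clear Hv.
destruct (bigO_ex_derive (ce_rho CE) He Hx) as [rt rx].
destruct (bigO_ex_derive (ce_h CE) He Hx) as [ht hx].
destruct (bigO_ex_derive bigO_w He Hx) as [wt wx].
destruct (bigO_ex_derive bigO_velocity He Hx) as [Vt Vx].
destruct (bigO_ex_derive (bigO_of_rho bh bh_smooth) He Hx) as [bt bx].
pose proof (bh_smooth 1%nat _ Hdens : ex_derive bh (rho eps t x)) as Hbh.
assert (Dt_V : Dt (equilibrium_velocity eps) t x
  = d_rho V (rho eps t x) (h eps t x) * Dt (rho eps) t x
    + d_h V (rho eps t x) (h eps t x) * Dt (h eps) t x).
{ now apply (chain_rule dens V (fun s => rho eps s x) (fun s => h eps s x)). }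
pose proof (Dx_velocity eps He t x Hx) as Dx_V; simpl in Dx_V.
assert (Dt_dev : Dt (deviation eps) t x
  = Dt (v eps) t x - Dt (equilibrium_velocity eps) t x).
{ now apply Derive_minus. }
assert (Dx_dev : Dx (deviation eps) t x
  = Dx (v eps) t x - Dx (equilibrium_velocity eps) t x).
{ now apply Derive_minus. }
destruct (Derive_ext_Omega HO (w_of_h eps He) Hx) as [Dt_w Dx_w].
assert (Dt_b : Derive (fun s => bh (rho eps s x)) t
  = Dt (rho eps) t x * Derive bh (rho eps t x)).
{ now apply (Derive_comp bh (fun s => rho eps s x)). }
assert (Dx_b : Derive (fun y => bh (rho eps t y)) x
  = Dx (rho eps) t x * Derive bh (rho eps t x)).
{ now apply (Derive_comp bh (fun y => rho eps t y)). }
assert (Dt_w' : Dt (w eps) t x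
  = Dt (rho eps) t x * (h eps t x - bh (rho eps t x))
    + rho eps t x * (Dt (h eps) t x - Dt (rho eps) t x * Derive bh (rho eps t x))).
{ rewrite Dt_w; unfold Dt at 1.
  rewrite Derive_mult, Derive_minus, Dt_b; auto.
  now apply (ex_derive_minus (fun s => h eps s x)). }
assert (Dx_w' : Dx (w eps) t x
  = Dx (rho eps) t x * (h eps t x - bh (rho eps t x))
    + rho eps t x * (Dx (h eps) t x - Dx (rho eps) t x * Derive bh (rho eps t x))).
{ rewrite Dx_w; unfold Dx at 1.
  rewrite Derive_mult, Derive_minus, Dx_b; auto.
  now apply (ex_derive_minus (fun y => h eps t y)). }
assert (Dx_rv : Dx (fun t x => rho eps t x * v eps t x) t x
  = Dx (rho eps) t x * v eps t x + rho eps t x * Dx (v eps) t x).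
{ now apply Derive_mult. }
assert (Dx_wv : Dx (fun t x => w eps t x * v eps t x) t x
  = Dx (w eps) t x * v eps t x + w eps t x * Dx (v eps) t x).
{ now apply Derive_mult. }
rewrite Dx_rv in E1; rewrite Dx_wv in E3.
change (h_of bh (rho eps) (w eps) t x) with (h eps t x) in *.
pose proof (w_of_h eps He t x Hx) as Ew; simpl in Ew.
unfold remainder, flux_factor, equilibrium_slope, lambda1.
rewrite Dt_dev, Dx_dev, Dt_V, Dx_V.
change (V (rho eps t x) (h eps t x)) with (equilibrium_velocity eps t x) in *.
unfold deviation.
set (r := rho eps t x) in *; set (y := h eps t x) in *.
set (c := Derive q y * Derive bh r * r) in *.
(* The third equation minus h - bh(rho) times the first, divided by rho. *)
assert (Hy : Dt (h eps) t x = Derive bh r * Dt (rho eps) t x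
  - v eps t x * (Dx (h eps) t x - Derive bh r * Dx (rho eps) t x)).
{ apply Rmult_eq_reg_l with r; [|lra].
  rewrite Dt_w', Dx_w', Ew in E3.
  nra. }
assert (Hr : Dt (rho eps) t x
  = - (Dx (rho eps) t x * v eps t x + r * Dx (v eps) t x)) by lra.
assert (Hd : v eps t x - equilibrium_velocity eps t x
  = - eps * (Dt (v eps) t x + (v eps t x - c) * Dx (v eps) t x)).
{ rewrite E2; field; lra. }
rewrite Hd, Hy, Hr; ring.
Qed.

(** Conservation gives u_t + (V_C u)_x = - (u D)_x, and [deviation_expansion]
    turns the right-hand side into - eps phi_x + eps (u E)_x. *)
Lemma conserved_quantity_correction (u phi : family) :
  O(0) u ->
  on_Omega Omega eps0 (fun eps t x =>
    Dt (u eps) t x + Dx (fun t x => u eps t x * v eps t x) t x = 0) ->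
  on_Omega Omega eps0 (fun eps t x =>
    phi eps t x = u eps t x * (flux_factor (rho eps t x) (h eps t x)
                                 * Dx (equilibrium_velocity eps) t x)) ->
  O(2) (fun eps t x =>
    equilibrium_lhs bh V (rho eps) (w eps) (u eps) t x
    - - eps * Dx (phi eps) t x).
Proof.
intros Hu Hcons Hphi.
pose proof (ce_open CE) as HO; pose proof (ce_sub CE) as HK.
pose proof (bigO_mult HO HK Hu bigO_remainder) as HuE.
refine (bigO_ext HO HK _ (bigO_mult HO HK
  (bigO_eps HO HK) (bigO_Dx HuE))).
intros eps He t x Hx; unfold equilibrium_lhs.
pose proof (Hcons eps He t x Hx) as Hc; simpl in Hc.
destruct (ce_smooth CE eps He) as (_ & Hv & _).
destruct (Hv 1%nat t x Hx) as (_ & _ & vx & _); clear Hv.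
destruct (bigO_ex_derive Hu He Hx) as [_ ux].
destruct (bigO_ex_derive bigO_velocity He Hx) as [_ Vx].
destruct (bigO_ex_derive HuE He Hx) as [_ Ex].
assert (Huv : ex_derive (fun y => u eps t y * v eps t y) x)
  by now apply ex_derive_mult.
assert (HVu : ex_derive (fun y => equilibrium_velocity eps t y * u eps t y) x)
  by now apply ex_derive_mult.
assert (Hflux : eps * Dx (phi eps) t x
  = Dx (fun t x => u eps t x * v eps t x) t x
    - Dx (fun t x => equilibrium_velocity eps t x * u eps t x) t x
    + eps * Dx (fun t x => u eps t x * remainder eps t x) t x).
{ unfold Dx.
  rewrite <- !Derive_scal, <- Derive_minus, <- Derive_plus; auto.
  - apply (Derive_ext_Omega HO (f := fun t x => eps * phi eps t x)
      (g := fun t x =>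
         u eps t x * v eps t x - equilibrium_velocity eps t x * u eps t x
         + eps * (u eps t x * remainder eps t x))); [|exact Hx].
    intros s y Hy; rewrite (Hphi eps He s y Hy).
    generalize (deviation_expansion eps He s y Hy); unfold deviation at 1.
    intros Hd.
    replace (v eps s y) with (equilibrium_velocity eps s y
      + (v eps s y - equilibrium_velocity eps s y)) by ring.
    rewrite Hd; ring.
  - now apply (ex_derive_minus (fun y => u eps t y * v eps t y)).
  - now apply (ex_derive_scal (fun y => u eps t y * remainder eps t y)). }
change (V_of bh V (rho eps) (w eps)) with (equilibrium_velocity eps).
lra.
Qed.

Lemma correction_along_solutions :
  O(2) (fun eps t x =>
    equilibrium_lhs bh V (rho eps) (w eps) (rho eps) t x
    - - eps * Dx (fun t x =>
        fst (diffusive_flux bh (mu_C bh q V) (rho eps) (w eps) t x)) t x) /\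
  O(2) (fun eps t x =>
    equilibrium_lhs bh V (rho eps) (w eps) (w eps) t x
    - - eps * Dx (fun t x =>
        snd (diffusive_flux bh (mu_C bh q V) (rho eps) (w eps) t x)) t x).
Proof.
split.
- apply (conserved_quantity_correction rho (fun eps t x =>
    fst (diffusive_flux bh (mu_C bh q V) (rho eps) (w eps) t x))).
  + exact (ce_rho CE).
  + intros eps He t x Hx; exact (proj1 (ce_solves CE eps He t x Hx)).
  + intros eps He t x Hx; rewrite (Dx_velocity eps He t x Hx).
    unfold diffusive_flux, matvec, dot, mu_C, flux_factor, hesitation; simpl.
    ring.
- apply (conserved_quantity_correction w (fun eps t x =>
    snd (diffusive_flux bh (mu_C bh q V) (rho eps) (w eps) t x))).
  + exact bigO_w.
  + intros eps He t x Hx; exact (proj2 (proj2 (ce_solves CE eps He t x Hx))).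
  + intros eps He t x Hx; rewrite (Dx_velocity eps He t x Hx).
    rewrite (w_of_h eps He t x Hx) at 1.
    unfold diffusive_flux, matvec, dot, mu_C, flux_factor, hesitation; simpl.
    ring.
Qed.

End Expansion.

Theorem theorem4p3 (dens : R -> Prop) (bh q : R -> R) (V : R -> R -> R)
    (dens_open : open dens)
    (bh_smooth : smooth1 dens bh)
    (q_smooth : smooth1 (fun _ => True) q)
    (V_smooth : smooth2 (fun r _ => dens r) V) :
  first_order_correction dens bh q V (mu_C bh q V) /\
  ((forall r h : R, 0 < r -> dens r ->
      Derive q h * Derive bh r * r = V r h - lambda1 bh V r h /\
      V r h - lambda1 bh V r h
        = - (r * (d_rho V r h + Derive bh r * d_h V r h))) ->
   coincides_with_equilibrium dens bh q V).
Proof.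
assert (HB : first_order_correction dens bh q V (mu_C bh q V)).
{ intros Omega K eps0 rho v w v1 CE.
  eapply correction_along_solutions; eauto. }
split; [exact HB |].
intros Hrel Omega K eps0 rho v w v1 CE.
pose proof (ce_open CE) as HO; pose proof (ce_sub CE) as HK.
assert (Hflux : on_Omega Omega eps0 (fun eps t x =>
  diffusive_flux bh (mu_C bh q V) (rho eps) (w eps) t x = (0, 0))).
{ intros eps He t x Hx.
  destruct (ce_pos CE eps He t x Hx) as [Hpos Hd].
  unfold diffusive_flux, matvec, dot, mu_C; simpl.
  rewrite (proj1 (Hrel _ (h_of bh (rho eps) (w eps) t x) Hpos Hd)).
  f_equal; ring. }
destruct (HB Omega K eps0 rho v w v1 CE) as [H1 H2].
split; [revert H1 | revert H2]; apply bigO_ext; auto;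
  intros eps He t x Hx;
  [ rewrite (proj2 (Derive_ext_Omega HO (g := fun _ _ => fst (0, 0))
      (fun s y Hy => f_equal fst (Hflux eps He s y Hy)) Hx))
  | rewrite (proj2 (Derive_ext_Omega HO (g := fun _ _ => snd (0, 0))
      (fun s y Hy => f_equal snd (Hflux eps He s y Hy)) Hx)) ];
  unfold Dx at 1; rewrite Derive_const; ring.
Qed.
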